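(* Let $n,k,r,d$ be non-negative integers with $n\ge k\ge r>d$. Then $${n\brace k}_{r,d} = {n\brace k}_{r-1,d} - (r-d-1)\,{n-1\brace k}_{r-1,d}.$$
   Context: For non-negative integers $n,k,r,d$ with $n\ge r$, ${n\brace k}_{r,d}$ (the $(r,d)$-Stirling number of the second kind) denotes the number of partitions of $\{1,\dots,n\}$ into $k$ non-empty subsets such that the elements $1,\dots,r$ lie in pairwise different subsets and any two distinct elements $i,j$ in the same subset satisfy $|i-j|>d$ (for $n=0$ the empty partition counts as one partition into $0$ subsets). It is $0$ when $n<r$. The same definition is used when the first lower index is at most $d$. *)

(* Defs.v *)
From mathcomp Require Import all_boot all_order all_algebra.
Set Implicit Arguments.
Unset Strict Implicit.
Unset Printing Implicit Defensive.

(* The element i of {1, ..., n} is represented by the ordinal of value i - 1;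
   thus 1, ..., r are the ordinals of value < r, and differences are kept.
   In `|i - j| the subtraction is that of int, not the truncated one on nat. *)

Definition rd_partition (n r d : nat) (P : {set {set 'I_n}}) : bool :=
  [&& partition P [set: 'I_n],
      [forall i : 'I_n, forall j : 'I_n,
         [&& i < r, j < r & i != j] ==> (pblock P i != pblock P j)]
    & [forall B in P, forall i in B, forall j in B,
         (i != j) ==> (d < `|i - j|)]].

(* The guard r <= n matters: for n < r, rd_partition would only separate the
   n available elements, whereas the number is 0 by convention. *)
Definition stirling2_rd (n k r d : nat) : nat :=
  if r <= n then #|[set P : {set {set 'I_n}} | rd_partition r d P & #|P| == k]|
  else 0.

(* Main.v *)
Require Import Defs.
From mathcomp Require Import all_boot all_order all_algebra.
From mathcomp Require Import zify.
Import GRing.Theory Num.Theory.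
Local Open Scope ring_scope.

(** The partitions counted by [stirling2_rd n k r d] are the partitions into
    [k] stable sets of a graph on [1, ..., n]: two distinct elements are
    adjacent when both are at most [r] or when they are at distance at most [d]
    ([rd_partitionE]).  The identity is an instance of deletion-contraction.

    Put [s = r - 1].  Passing from [s] to [r] adds exactly the edges joining [r]
    to the elements [i <= s - d]; the other elements of [1, ..., s] are already
    adjacent to [r] by distance.  So a partition that is valid for [s] but not
    for [r] puts [r] in the block of some [i <= s - d], and of only one such [i],
    since [1, ..., s] lie in different blocks.

    For each of these [r - d - 1] values of [i], identifying [i] with [r] must
    leave the graph with parameters [n - 1], [s], [d] ([card_rd_merged]).  This
    holds if the elements are renumbered by deleting the label [i], so that the
    merged element takes the label [s] of the shifted [r].  Deleting [r] instead
    would be wrong: it brings elements on the two sides of [r] closer together,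
    possibly within distance [d].  Deleting [i] also shortens by one the
    distances across [i], but harmlessly: an element below [i <= s - d] and one
    above [r] are at distance at least [d + 3] before the deletion, and all other
    pairs across [i] are adjacent both in the quotient graph and in the smaller
    conflict graph.

    That identifying two vertices of a graph does give a bijection between
    stable partitions is [card_stable_merged]; it rests on pulling partitions
    back along the quotient map. *)

(** * Stable partitions of a graph *)

Definition stable_partition {T : finType} (e : rel T) (P : {set {set T}}) :=
  partition P [set: T]
  && [forall x, forall y, e x y ==> (pblock P x != pblock P y)].

Lemma stable_partitionP {T : finType} {e : rel T} {P : {set {set T}}} :
  reflect (partition P [set: T] /\
           forall x y, e x y -> pblock P x <> pblock P y)
          (stable_partition e P).
Proof.
apply: (iffP andP) => -[partP sP]; split=> //.
  by move=> x y exy; apply/eqP; move/forallP/(_ x)/forallP/(_ y): sP; rewrite exy.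
by apply/'forall_forallP=> x y; apply/implyP=> /sP/eqP.
Qed.

(** The distance bound uses both truncated subtractions instead of an absolute
    difference, so that all comparisons of labels stay in [nat]. *)
Definition rd_conflict {n : nat} (r d : nat) : rel 'I_n := fun x y =>
  (x != y) && (((x < r) && (y < r)) || ((x - y <= d) && (y - x <= d)))%N.

Lemma mem_pblock_setT {T : finType} {P : {set {set T}}} (x : T) :
  partition P [set: T] -> x \in pblock P x.
Proof. by move=> /cover_partition covP; rewrite mem_pblock covP inE. Qed.

Lemma rd_partitionE (n r d : nat) (P : {set {set 'I_n}}) :
  rd_partition r d P = stable_partition (@rd_conflict n r d) P.
Proof.
apply/and3P/stable_partitionP=> [[partP /'forall_forallP sepP farP]|[partP sP]].
  split=> // x y /andP[nxy /orP[ltr|led]] eqb.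
    by move/implyP: (sepP x y); rewrite andbA ltr nxy eqb eqxx => /(_ isT).
  have Bx : pblock P x \in P.
    by rewrite pblock_mem // (cover_partition partP) inE.
  move/forall_inP/(_ _ Bx)/forall_inP/(_ x (mem_pblock_setT _ partP)): farP.
  move/forall_inP/(_ y); rewrite nxy /= eqb mem_pblock_setT // => /(_ isT).
  lia.
split=> //.
  apply/'forall_forallP=> x y; apply/implyP=> /and3P[xr yr nxy].
  by apply/eqP/sP; rewrite /rd_conflict nxy xr yr.
apply/forall_inP=> B PB; apply/forall_inP=> x xB; apply/forall_inP=> y yB.
apply/implyP=> nxy; case/and3P: (partP) => _ tiP _.
rewrite ltnNge; apply/negP=> led; apply: (sP x y).
  by rewrite /rd_conflict nxy /=; apply/orP; right; lia.
by rewrite !(def_pblock tiP PB).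
Qed.

(** * Pulling partitions back along a retraction *)

Definition pullback {T U : finType} (f : T -> U) (Q : {set {set U}}) :
  {set {set T}} := [set f @^-1: B | B : {set U} in Q].

Lemma preimset_inj {T U : finType} {f : T -> U} {s : U -> T} :
  cancel s f -> injective (fun B : {set U} => f @^-1: B).
Proof.
move=> fK A B eqAB; apply/setP=> u.
by move/setP/(_ (s u)): eqAB; rewrite !inE fK.
Qed.

Lemma partition_pullback {T U : finType} {f : T -> U} {s : U -> T}
    (Q : {set {set U}}) :
  cancel s f ->
  partition (pullback f Q) [set: T] = partition Q [set: U].
Proof.
move=> fK; have inj := preimset_inj fK.
have covE x : (x \in cover (pullback f Q)) = (f x \in cover Q).
  apply/bigcupP/bigcupP=> [[_ /imsetP[B QB ->]]|[B QB]].
    by rewrite inE; exists B.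
  by exists (f @^-1: B); rewrite ?imset_f ?inE.
congr [&& _, _ & _].
- apply/eqP/eqP=> /setP E; apply/setP=> u.
    by move: (E (s u)); rewrite covE fK !inE.
  by rewrite covE E !inE.
- apply/trivIsetP/trivIsetP=> tiQ.
    move=> A B QA QB nAB; apply/pred0P=> u /=; apply/negP=> /andP[uA uB].
    have := tiQ _ _ (imset_f _ QA) (imset_f _ QB).
    rewrite (inj_eq inj) => /(_ nAB)/pred0P/(_ (s u)) /=.
    by rewrite !inE fK uA uB.
  move=> _ _ /imsetP[A QA ->] /imsetP[B QB ->]; rewrite (inj_eq inj) => nAB.
  apply/pred0P=> x /=; rewrite !inE.
  exact: (pred0P (tiQ _ _ QA QB nAB) (f x)).
- by rewrite -[in LHS](preimset0 f) (mem_imset _ _ inj).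
Qed.

Lemma pblock_pullback {T U : finType} {f : T -> U} {s : U -> T}
    {Q : {set {set U}}} (x : T) :
  cancel s f -> partition Q [set: U] ->
  pblock (pullback f Q) x = f @^-1: pblock Q (f x).
Proof.
move=> fK partQ; apply: def_pblock.
- by move: partQ; rewrite -(partition_pullback _ fK) => /and3P[].
- by rewrite imset_f // pblock_mem // (cover_partition partQ) inE.
- by rewrite inE mem_pblock_setT.
Qed.

(** The hypotheses say that [e'] is the image of [e] under [f], as when [f]
    contracts a graph.  Two elements share a block of the pullback exactly when
    their images share a block of [Q], so stability transfers both ways. *)
Lemma stable_pullback {T U : finType} {f : T -> U} {s : U -> T}
    {e : rel T} {e' : rel U} (Q : {set {set U}}) :
  cancel s f ->
  (forall x y, e x y -> e' (f x) (f y)) ->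
  (forall u v, e' u v -> exists x y, [/\ f x = u, f y = v & e x y]) ->
  stable_partition e (pullback f Q) = stable_partition e' Q.
Proof.
move=> fK f_hom f_lift; have partE := partition_pullback Q fK.
apply/stable_partitionP/stable_partitionP=> -[partQ sQ].
  have partQ' : partition Q [set: U] by rewrite -partE.
  split=> // u v /f_lift[x [y [<- <- /sQ neq]]] eqb; apply: neq.
  by rewrite !(pblock_pullback _ fK) // eqb.
rewrite partE; split=> // x y /f_hom/sQ neq.
rewrite !(pblock_pullback _ fK) // => eqb.
exact/neq/(preimset_inj fK).
Qed.

(** A partition whose blocks are unions of fibres of [f] comes from the
    quotient; the preimage along a section provides the quotient partition. *)
Lemma pullback_section {T U : finType} (f : T -> U) (s : U -> T)
    (P : {set {set T}}) :
  partition P [set: T] -> (forall x, pblock P (s (f x)) = pblock P x) ->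
  pullback f (pullback s P) = P.
Proof.
move=> /and3P[/eqP covP tiP _] same.
have preimE B : B \in P -> f @^-1: (s @^-1: B) = B.
  move=> PB; apply/setP=> x; rewrite !inE.
  apply/idP/idP=> [sxB|xB].
    by rewrite -(def_pblock tiP PB sxB) same mem_pblock covP inE.
  by rewrite -(def_pblock tiP PB xB) -same mem_pblock covP inE.
rewrite /pullback -imset_comp -[RHS]imset_id.
exact: eq_in_imset.
Qed.

(** * Merging two vertices *)

Definition stable_partitions {T : finType} (e : rel T) (k : nat) :=
  [set P | stable_partition e P & #|P| == k].

(** The map that identifies [i] with [lift i j], the target being numbered by
    deleting [i]; it is a retraction of [lift i]. *)
Definition contract {n : nat} (i : 'I_n.+1) (j : 'I_n) (x : 'I_n.+1) : 'I_n :=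
  odflt j (unlift i x).

Lemma contract_lift {n : nat} (i : 'I_n.+1) (j : 'I_n) :
  cancel (lift i) (contract i j).
Proof. by move=> u; rewrite /contract liftK. Qed.

Lemma contract_id (n : nat) (i : 'I_n.+1) (j : 'I_n) : contract i j i = j.
Proof. by rewrite /contract unlift_none. Qed.

(** The contraction half of deletion-contraction: [e'] is the image of [e] when
    [i] and [lift i j] are identified, and pullback along [contract i j] is the
    bijection; it preserves the number of blocks because [contract i j] is
    surjective. *)
Lemma card_stable_merged (n : nat) (i : 'I_n.+1) (j : 'I_n)
    (e : rel 'I_n.+1) (e' : rel 'I_n) (k : nat) :
  (forall x y, e x y -> e' (contract i j x) (contract i j y)) ->
  (forall u v, e' u v ->
     exists x y, [/\ contract i j x = u, contract i j y = v & e x y]) ->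
  #|[set P in stable_partitions e k | pblock P i == pblock P (lift i j)]|
    = #|stable_partitions e' k|.
Proof.
move=> f_hom f_lift; have fK := contract_lift i j.
have inj := preimset_inj fK.
have stE Q := stable_pullback Q fK f_hom f_lift.
rewrite -[RHS](card_imset _ (imset_inj inj)).
congr #|pred_of_set _|; apply/setP=> P; rewrite !inE.
apply/andP/imsetP=> [[/andP[sP cP] /eqP eqb]|[Q]].
  (* The only fibre with two elements is that of [j], made of [i] and
     [lift i j], which are in one block by assumption. *)
  have PE : P = pullback (contract i j) (pullback (lift i) P).
    rewrite pullback_section //; first by case/andP: sP.
    by move=> x; case: (unliftP i x) => [u|] ->; rewrite ?fK ?contract_id.
  exists (pullback (lift i) P) => //.
  by rewrite inE -stE -PE sP -(card_imset _ inj) -[imset _ _]PE.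
rewrite inE => /andP[sQ cQ] ->.
rewrite [stable_partition _ _]stE sQ (card_imset _ inj) cQ; split=> //.
case/andP: sQ => partQ _.
by rewrite !(pblock_pullback _ fK) // fK contract_id.
Qed.

(** * Deletion-contraction for the conflict graph *)

(** Here [lift i j] has value [s], so it is the element [s + 1] and [i] is one
    of the first [s - d].  Merging them is the same as forgetting [i]: in the
    smaller graph [j] has value [s - 1], so it inherits from [i] the adjacency to
    the other separated elements, and keeps from [lift i j] the adjacency to the
    next [d] elements. *)
Lemma card_rd_merged (n s d k : nat) (i : 'I_n.+1) (j : 'I_n) :
  (i + d < s)%N -> lift i j = s :> nat ->
  #|[set P in stable_partitions (@rd_conflict n.+1 s d) k
      | pblock P i == pblock P (lift i j)]|
    = #|stable_partitions (@rd_conflict n s d) k|.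
Proof.
move=> lt_is js; apply: card_stable_merged.
  move=> x y; case: (unliftP i x) => [u|] ->; case: (unliftP i y) => [v|] ->;
    rewrite ?contract_id ?contract_lift /rd_conflict -!val_eqE /=;
    move: js; rewrite /= /bump; lia.
move=> u v; have [ltuv|] := boolP ((u < s)%N && (v < s)%N).
  (* An edge between [j] and another separated element comes from [i], not
     from [lift i j], which need not be adjacent to it. *)
  case: (eqVneq u j) => [->|nuj]; [|case: (eqVneq v j) => [->|nvj]].
  - move=> e'jv; exists i, (lift i v).
    rewrite contract_id contract_lift; split=> //.
    move: e'jv ltuv js; rewrite /rd_conflict -!val_eqE /= /bump; lia.
  - move=> e'uj; exists (lift i u), i.
    rewrite contract_id contract_lift; split=> //.
    move: e'uj ltuv js; rewrite /rd_conflict -!val_eqE /= /bump; lia.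
  move=> e'uv; exists (lift i u), (lift i v); rewrite !contract_lift; split=> //.
  move: nuj nvj e'uv ltuv js; rewrite /rd_conflict -!val_eqE /= /bump; lia.
(* One endpoint is at least [s] and the other within [d] of it, so both are at
   least [s - d > i]: both labels are shifted and the distance is kept. *)
move=> nlt e'uv; exists (lift i u), (lift i v); rewrite !contract_lift.
split=> //; move: e'uv nlt js; rewrite /rd_conflict -!val_eqE /= /bump; lia.
Qed.

(** The partitions lost when [s + 1] joins the separated elements are sorted
    by the element sharing a block with [s + 1], which ranges over the first
    [s - d]. *)
Lemma card_rd_rec {n : nat} (k s d : nat) : (s <= n)%N ->
  #|stable_partitions (@rd_conflict n.+1 s d) k| =
  (#|stable_partitions (@rd_conflict n.+1 s.+1 d) k|
   + (s - d) * #|stable_partitions (@rd_conflict n s d) k|)%N.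
Proof.
move=> le_sn.
have le_w : (s - d <= n.+1)%N by lia.
pose w : 'I_(s - d) -> 'I_n.+1 := widen_ord le_w.
pose z : 'I_n.+1 := inord s.
have zs : z = s :> nat by rewrite inordK.
pose F i := [set P in stable_partitions (@rd_conflict n.+1 s d) k
               | pblock P (w i) == pblock P z].
set A := stable_partitions _ _; set B := stable_partitions _ _.
have sBA : B \subset A.
  apply/subsetP=> P; rewrite !inE => /andP[/stable_partitionP[partP sP] ->].
  rewrite andbT; apply/stable_partitionP; split=> // x y exy; apply: sP.
  by move: exy; rewrite /rd_conflict; lia.
have DE : A :\: B = \bigcup_i F i.
  apply/setP=> P; rewrite in_setD; apply/andP/bigcupP=> [[nBP AP]|[i _]].
    move: (AP) nBP; rewrite !inE => /andP[/[dup] sP /andP[partP _] ->].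
    rewrite andbT /stable_partition partP /= negb_forall.
    case/existsP=> x; rewrite negb_forall => /existsP[y].
    rewrite negb_imply negbK => /andP[exy /eqP eqb].
    have [_ sep] := stable_partitionP sP.
    have nexy : ~~ rd_conflict s d x y.
      by apply/negP=> /sep; rewrite eqb.
    have [[xz ys]|[yz xs]] : (x = z /\ y + d < s)%N \/ (y = z /\ x + d < s)%N.
      have /orP[/andP[/eqP ? ?]|/andP[/eqP ? ?]] :
          ((x == s :> nat) && (y + d < s) || (y == s :> nat) && (x + d < s))%N.
        by move: exy nexy; rewrite /rd_conflict -!val_eqE /=; lia.
      - by left; split=> //; apply/val_inj; rewrite /= zs.
      - by right; split=> //; apply/val_inj; rewrite /= zs.
    - have lty : (y < s - d)%N by lia.
      exists (Ordinal lty); rewrite // inE AP /= -xz eqb; apply/eqP.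
      by congr (pblock P _); apply/val_inj.
    - have ltx : (x < s - d)%N by lia.
      exists (Ordinal ltx); rewrite // inE AP /= -yz -eqb; apply/eqP.
      by congr (pblock P _); apply/val_inj.
  rewrite inE => /andP[AP /eqP eqb]; split=> //.
  rewrite inE negb_and; apply/orP; left; apply/negP.
  case/stable_partitionP=> _ /(_ (w i) z)[] //.
  by rewrite /rd_conflict -val_eqE /= zs; have := ltn_ord i; lia.
(* Two of the first [s] elements never share a block, so at most one of them
   is in the block of [z]. *)
have djF i1 i2 : i1 != i2 -> [disjoint F i1 & F i2].
  move=> ni; apply/pred0P=> P /=; apply/negP; rewrite !inE.
  case/andP=> /andP[/andP[/stable_partitionP[_ sP] _] /eqP e1] /andP[_ /eqP e2].
  apply: (sP (w i1) (w i2)); last by rewrite e1 e2.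
  move: ni; rewrite /rd_conflict -!val_eqE /=.
  by have := ltn_ord i1; have := ltn_ord i2; lia.
have cF i : #|F i| = #|stable_partitions (@rd_conflict n s d) k|.
  have lti := ltn_ord i.
  have nwz : w i != z by rewrite -val_eqE /= zs; lia.
  case: (unlift_some nwz) => j zj _.
  by rewrite /F zj; apply: card_rd_merged; [rewrite /=; lia | rewrite -zj].
rewrite -(cardsID B A) (setIidPr sBA) DE; congr addn.
rewrite -sum1_card partition_disjoint_bigcup //=.
under eq_bigr => i _ do rewrite sum1_card cF.
by rewrite sum_nat_const card_ord.
Qed.

Lemma stirling2_rdE (n k r d : nat) : (r <= n)%N ->
  stirling2_rd n k r d = #|stable_partitions (@rd_conflict n r d) k|.
Proof.
rewrite /stirling2_rd => ->; congr #|pred_of_set _|.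
by apply/setP=> P; rewrite !inE rd_partitionE.
Qed.

Theorem theorem1p4 (n k r d : nat) (hkn : (k <= n)%N) (hrk : (r <= k)%N)
    (hdr : (d < r)%N) :
  (stirling2_rd n k r d)%:Z =
    (stirling2_rd n k (r - 1)%N d)%:Z
    - (r%:Z - d%:Z - 1) * (stirling2_rd (n - 1)%N k (r - 1)%N d)%:Z.
Proof.
have le_rn := leq_trans hrk hkn.
case: r => [|s] // in hrk hdr le_rn *; case: n => [|n] // in hkn le_rn *.
have le_sn := ltnW le_rn.
rewrite !subn1 /= !stirling2_rdE //.
rewrite (card_rd_rec k s d) // PoszD PoszM -subzn //.
have -> : s.+1%:Z - d%:Z - 1 = s%:Z - d%:Z by lia.
by rewrite addrK.
Qed.
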